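(* Let $n \in \mathbb{N}$ with $n \ge 1$ and let $B, \tilde{B} \in \{0,1\}^n \setminus \{(1,0,\dots,0)\}$ be $n$-bit strings. Let $\tau$ denote the takum decoding function and let $\preceq$ be the two's complement signed integer order on $\{0,1\}^n$. Then $$B \preceq \tilde{B} \;\Longrightarrow\; \tau(B) \le \tau(\tilde{B}).$$
   Context: Two's complement order. For $B = (B_{n-1},\dots,B_0) \in \{0,1\}^n$ (MSB to LSB) let $\mathrm{SI}(B) := -B_{n-1}2^{n-1} + \sum_{i=0}^{n-2} B_i 2^i$. For $n$-bit strings, $B \preceq \tilde{B}$ means $\mathrm{SI}(B) \le \mathrm{SI}(\tilde{B})$. Takum encoding. Let $n \in \mathbb{N}$ with $n \ge 12$. An $n$-bit string, written from most significant bit (MSB) to least significant bit (LSB), is split as $(S,D,R,C,M) \in \{0,1\}^n$, where: - $S \in \{0,1\}$ is the sign bit (1 bit) and $D \in \{0,1\}$ is the direction bit (1 bit); - $R = (R_2,R_1,R_0) \in \{0,1\}^3$ are the regime bits, and the regime is $r := 7 - (4R_2 + 2R_1 + R_0)$ if $D=0$, and $r := 4R_2+2R_1+R_0$ if $D=1$, so $r \in \{0,\dots,7\}$; - $C = (C_{r-1},\dots,C_0) \in \{0,1\}^r$ are the characteristic bits, and the characteristic is $c := -2^{r+1}+1+\sum_{i=0}^{r-1} C_i 2^i$ if $D=0$, and $c := 2^r - 1 + \sum_{i=0}^{r-1} C_i 2^i$ if $D=1$; - $p := n-r-5 \in \{n-12,\dots,n-5\}$ is the mantissa bit count, $M = (M_{p-1},\dots,M_0)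 \in \{0,1\}^p$ are the mantissa bits, and $m := 2^{-p}\sum_{i=0}^{p-1} M_i 2^i \in [0,1)$ is the mantissa; - $\ell := (-1)^S (c+m)$ is the logarithmic value. The takum value is $\tau((S,D,R,C,M)) := 0$ if $S=0$ and all bits of $D,R,C,M$ are zero; $:= \mathrm{NaR}$ (''not a real'', a special non-real symbol) if $S=1$ and all bits of $D,R,C,M$ are zero; and $:= (-1)^S (\sqrt{\mathrm{e}})^{\ell}$ otherwise, where $\mathrm{e}$ is Euler's number. For $n < 12$, the value of a string is obtained by assuming the missing (least significant) bits to be zero (''ghost bits''), i.e. by appending zero bits on the LSB side until length 12. The only $n$-bit string with value $\mathrm{NaR}$ is $(1,0,\dots,0)$, so both values in the claim are real numbers. *)

(* Defs.v *)
(* MathComp / MathComp-Analysis development. *)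
From HB Require Import structures.
From mathcomp Require Import all_boot all_order all_algebra.
From mathcomp Require Import all_classical all_reals all_analysis.

Set Implicit Arguments.
Unset Strict Implicit.
Unset Printing Implicit Defensive.

Import Order.TTheory GRing.Theory Num.Theory.
Local Open Scope ring_scope.

(* Bit strings are sequences of booleans written from the most significant bit
   to the least significant bit; [bit s i] is the bit of weight 2 ^ i. *)
Definition bit (s : seq bool) (i : nat) : bool := nth false (rev s) i.

Definition unsigned (s : seq bool) : nat :=
  (\sum_(i < size s) bit s i * 2 ^ i)%N.

Definition SI (n : nat) (B : n.-tuple bool) : int :=
  - ((bit B n.-1)%:Z * 2 ^+ n.-1) + \sum_(i < n.-1) (bit B i)%:Z * 2 ^+ i.

Definition tc_le (n : nat) (B B' : n.-tuple bool) : bool := SI B <= SI B'.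

(* The fields of a string (S, D, R, C, M) of length at least 12. *)
Definition sign_bit (s : seq bool) : bool := nth false s 0.
Definition direction_bit (s : seq bool) : bool := nth false s 1.
Definition regime_bits (s : seq bool) : seq bool := take 3 (drop 2 s).

Definition regime (s : seq bool) : nat :=
  if direction_bit s then unsigned (regime_bits s)
  else (7 - unsigned (regime_bits s))%N.

Definition characteristic_bits (s : seq bool) : seq bool :=
  take (regime s) (drop 5 s).

Definition characteristic (s : seq bool) : int :=
  let r := regime s in
  if direction_bit s then 2 ^+ r - 1 + (unsigned (characteristic_bits s))%:Z
  else - 2 ^+ r.+1 + 1 + (unsigned (characteristic_bits s))%:Z.

Definition mantissa_bit_count (s : seq bool) : nat := (size s - regime s - 5)%N.

Definition mantissa_bits (s : seq bool) : seq bool := drop (5 + regime s) s.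

Definition mantissa (R : realType) (s : seq bool) : R :=
  2 ^- mantissa_bit_count s * (unsigned (mantissa_bits s))%:R.

Definition logarithmic_value (R : realType) (s : seq bool) : R :=
  (-1) ^+ sign_bit s * ((characteristic s)%:~R + mantissa R s).

(* [None] stands for NaR. Meaningful for strings of length at least 12. *)
Definition takum_long (R : realType) (s : seq bool) : option R :=
  if all negb (behead s) then (if sign_bit s then None else Some 0)
  else Some ((-1) ^+ sign_bit s
             * Num.sqrt (expR 1 : R) `^ logarithmic_value R s).

(* Ghost bits; the identity on strings of length at least 12. *)
Definition ghost_extend (s : seq bool) : seq bool :=
  s ++ nseq (12 - size s) false.

Definition takum (R : realType) (n : nat) (B : n.-tuple bool) : option R :=
  takum_long R (ghost_extend B).

Definition NaR_string (n : nat) : seq bool := true :: nseq n.-1 false.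

(* Main.v *)
(* On the bits below the sign bit, write k for the number formed by the
   direction and regime bits, and u for the number formed by the N remaining
   bits.  Then c + m = base k + 2 ^ r * (u / 2 ^ N), because shifting the
   mantissa below the characteristic just splits u at its r leading bits.  As
   u / 2 ^ N < 1 and base k + 2 ^ r = base (k + 1), the number c + m is monotone
   in 2 ^ N * k + u. *)
Require Import Defs.
From mathcomp Require Import all_boot all_order all_algebra.
From mathcomp Require Import all_classical all_reals all_analysis.
From mathcomp Require Import zify ring.

Import Order.TTheory GRing.Theory Num.Theory.
Local Open Scope ring_scope.

Lemma unsigned_cons (b : bool) (s : seq bool) :
  unsigned (b :: s) = (b * 2 ^ size s + unsigned s)%N.
Proof.
rewrite /unsigned /= big_ord_recr /= /bit rev_cons nth_rcons size_rev ltnn eqxx.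
rewrite addnC; congr (_ + _)%N; apply: eq_bigr => i _.
by rewrite nth_rcons size_rev ltn_ord.
Qed.

Lemma unsigned_nil : unsigned [::] = 0%N.
Proof. by rewrite /unsigned big_ord0. Qed.

Lemma unsigned_lt (s : seq bool) : (unsigned s < 2 ^ size s)%N.
Proof.
elim: s => [|b s IH]; first by rewrite unsigned_nil.
by rewrite unsigned_cons /= expnS; case: b; lia.
Qed.

Lemma unsigned_cat (s t : seq bool) :
  unsigned (s ++ t) = (unsigned s * 2 ^ size t + unsigned t)%N.
Proof.
elim: s => [|b s IH]; first by rewrite unsigned_nil.
by rewrite cat_cons !unsigned_cons IH size_cat expnD mulnDl mulnA addnA.
Qed.

(** The tail is worth less than the weight of the leading bit, so the value determines the bits one
    by one. *)
Lemma unsigned_inj (s t : seq bool) :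
  size s = size t -> unsigned s = unsigned t -> s = t.
Proof.
elim: s t => [|b s IH] [|c t] //= [szE]; rewrite !unsigned_cons szE.
have := unsigned_lt s; have := unsigned_lt t; rewrite szE => ltt lts eqU.
have eqbc : b = c by case: b c eqU => -[]; lia.
by rewrite eqbc (IH t) //; move: eqU; rewrite eqbc; lia.
Qed.

Lemma unsigned_eq0 (s : seq bool) : (unsigned s == 0%N) = all negb s.
Proof.
elim: s => [|b s IH]; first by rewrite unsigned_nil.
by rewrite unsigned_cons addn_eq0 IH muln_eq0 expn_eq0 /=; case: b.
Qed.

Lemma unsigned_nseq_false (k : nat) : unsigned (nseq k false) = 0%N.
Proof. by apply/eqP; rewrite unsigned_eq0 all_nseq orbT. Qed.

Lemma SI_cons (n : nat) (B : n.-tuple bool) (b : bool) (s : seq bool) :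
  tval B = b :: s -> SI B = (unsigned s)%:Z - (b * 2 ^ size s)%N%:Z.
Proof.
move=> eqB; have eqn : n = (size s).+1 by rewrite -(size_tuple B) eqB.
rewrite /SI eqB eqn /= addrC /unsigned; congr (_ - _).
  rewrite (big_morph Posz PoszD (erefl _)); apply: eq_bigr => i _.
  by rewrite /bit rev_cons nth_rcons size_rev ltn_ord PoszM -!natz natrX.
by rewrite /bit rev_cons nth_rcons size_rev ltnn eqxx PoszM -!natz natrX.
Qed.

(** The least [c + m] for the given direction and regime, attained when all later bits vanish. *)
Definition regime_base (s : seq bool) : int :=
  if direction_bit s then 2 ^+ regime s - 1 else - 2 ^+ (regime s).+1 + 1.

Definition magnitude (R : realType) (s : seq bool) : R :=
  (characteristic s)%:~R + mantissa R s.

Lemma regime_le7 (s : seq bool) : (regime s <= 7)%N.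
Proof.
rewrite /regime; case: ifP => _; last exact: leq_subr.
have := unsigned_lt (regime_bits s).
have : (size (regime_bits s) <= 3)%N by rewrite size_take_min geq_minl.
by move=> /(leq_pexp2l (isT : (0 < 2)%N)); lia.
Qed.

Lemma magnitudeE (R : realType) (s : seq bool) : (12 <= size s)%N ->
  magnitude R s = (regime_base s)%:~R
    + 2 ^+ regime s * ((unsigned (drop 5 s))%:R / 2 ^+ (size s - 5)).
Proof.
move=> sz; have r7 := regime_le7 s.
have -> : magnitude R s = (regime_base s)%:~R
    + ((unsigned (characteristic_bits s))%:R + mantissa R s).
  rewrite /magnitude /characteristic /regime_base addrA.
  by case: ifP => _; rewrite intrD.
congr (_ + _).
have -> : drop 5 s = characteristic_bits s ++ mantissa_bits s.
  by rewrite /mantissa_bits addnC -drop_drop cat_take_drop.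
(* Since [r <= 7] and there are at least 12 bits, the truncated subtractions in [mantissa_bit_count]
   are exact. *)
have szM : size (mantissa_bits s) = mantissa_bit_count s.
  by rewrite size_drop /mantissa_bit_count; lia.
have -> : (size s - 5 = regime s + mantissa_bit_count s)%N.
  by rewrite /mantissa_bit_count; lia.
rewrite unsigned_cat szM natrD natrM natrX exprD /mantissa.
have h2 k : (2 : R) ^+ k != 0 by rewrite expf_neq0 ?pnatr_eq0.
by field; rewrite !h2.
Qed.

(** The ranges of [c + m] abut: for [D = 0], [- 2 ^ (r + 1) + 1 + 2 ^ r = - 2 ^ r + 1] is the base
    of regime [r - 1], or [0], the first base with [D = 1], when [r = 0]; for [D = 1],
    [2 ^ r - 1 + 2 ^ r = 2 ^ (r + 1) - 1]. The proof checks all pairs of four-bit prefixes. *)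
Lemma regime_base_lt (b b' : bool) (t t' h h' : seq bool) :
  size h = 4%N -> size h' = 4%N -> (unsigned h < unsigned h')%N ->
  regime_base (b :: h ++ t) + 2 ^+ regime (b :: h ++ t)
    <= regime_base (b' :: h' ++ t').
Proof.
case: h => [|d [|x [|y [|z [|]]]]] // _.
case: h' => [|d' [|x' [|y' [|z' [|]]]]] // _.
rewrite /regime_base /regime /direction_bit /regime_bits /= !take0.
rewrite !unsigned_cons unsigned_nil /=.
by case: d; case: x; case: y; case: z;
   case: d'; case: x'; case: y'; case: z'.
Qed.

Lemma le_magnitude (R : realType) (b b' : bool) (s s' : seq bool) :
  (11 <= size s)%N -> size s = size s' -> (unsigned s <= unsigned s')%N ->
  magnitude R (b :: s) <= magnitude R (b' :: s').
Proof.
move=> sz szE.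
rewrite !magnitudeE /= -?szE // subSS.
(* With the sign bit removed, the first four bits are direction and regime; the order is
   lexicographic in this prefix and the tail. *)
rewrite -(cat_take_drop 4 s) -(cat_take_drop 4 s').
set h := take 4 s; set h' := take 4 s'; set t := drop 4 s; set t' := drop 4 s'.
have szh : size h = 4%N by rewrite size_take; case: ifP => //; lia.
have szh' : size h' = 4%N by rewrite size_take; case: ifP => //; lia.
have szt : size t = (size s - 4)%N by rewrite size_drop.
have szt' : size t' = (size s - 4)%N by rewrite size_drop szE.
rewrite !drop_size_cat // !unsigned_cat !size_cat szh szt szt' addKn.
set N := (size s - 4)%N.
have := unsigned_lt t; have := unsigned_lt t'; rewrite szt szt' -/N.
move=> ltu' ltu leu.
have h2 : (0 : R) < 2 ^+ N by rewrite exprn_gt0.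
have [lth|geh] := ltnP (unsigned h) (unsigned h').
  have := regime_base_lt b b' t t' _ _ szh szh' lth.
  rewrite -(ler_int R) intrD rmorphXn /= => base_le.
  (* The left side stays below its base plus [2 ^ r] because its tail fraction is below 1; the right
     side is at least its own base. *)
  rewrite (le_trans _ (le_trans base_le _)) //.
    rewrite lerD2l ler_piMr ?exprn_ge0 // ler_pdivrMr // mul1r.
    by rewrite -natrX ler_nat ltnW.
  by rewrite lerDl mulr_ge0 ?exprn_ge0 // divr_ge0 // ltW.
(* A larger prefix on the left would outweigh any tail on the right, as tails are below [2 ^ N]. *)
have [eqh leut] : unsigned h = unsigned h' /\ (unsigned t <= unsigned t')%N.
  have [lth|geh'] := ltnP (unsigned h') (unsigned h); last by nia.
  by have : ((unsigned h').+1 * 2 ^ N <= unsigned h * 2 ^ N)%N;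
    [rewrite leq_mul2r lth orbT | nia].
have {}eqh : h = h' by apply: unsigned_inj; rewrite ?szh.
have eqD : direction_bit (b :: h ++ t) = direction_bit (b' :: h' ++ t').
  by rewrite -eqh /direction_bit /= !nth_cat szh.
have eqr : regime (b :: h ++ t) = regime (b' :: h' ++ t').
  have bitsE c u : regime_bits (c :: h ++ u) = drop 1 h.
    by rewrite /regime_bits /= drop_cat szh /= take_size_cat // size_drop szh.
  by rewrite /regime eqD -eqh !bitsE.
rewrite /regime_base eqD eqr lerD2l ler_wpM2l ?exprn_ge0 //.
by rewrite ler_wpM2r ?invr_ge0 ?(ltW h2) // ler_nat.
Qed.

Lemma sqrt_expR1_ge1 (R : realType) : 1 <= Num.sqrt (expR 1 : R).
Proof. by rewrite -[leLHS]sqrtr1 ler_wsqrtr // -expR0 ler_expR. Qed.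

Lemma le_takum_long (R : realType) (b b' : bool) (s s' : seq bool) :
  (11 <= size s)%N -> size s = size s' ->
  (b && (unsigned s == 0%N)) = false -> (b' && (unsigned s' == 0%N)) = false ->
  (b' <= b)%N -> (b == b' -> unsigned s <= unsigned s')%N ->
  exists x y : R, [/\ takum_long R (b :: s) = Some x,
    takum_long R (b' :: s') = Some y & x <= y].
Proof.
move=> sz szE nar nar' leb leu.
rewrite /takum_long /logarithmic_value /= -!unsigned_eq0 /sign_bit /=.
rewrite -!/(magnitude _ _).
set e := Num.sqrt _; have e1 : 1 <= e := sqrt_expR1_ge1 R.
case: b nar leb leu => /= [->|_] leb leu.
  case: b' nar' leb leu => /= [->|_] _ leu.
    do 2 eexists; split => //.
    (* Both negative: the sign negates the exponent and the power, and the two reversals cancel. *)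
    rewrite expr1 !mulN1r lerN2 ler_powR // lerN2.
    by apply: le_magnitude => //; rewrite leu.
  (* Opposite signs: the values are separated by 0. *)
  by case: eqP => _; do 2 eexists; split => //;
    rewrite expr1 mulN1r lerNl ?oppr0 ?expr0 ?mul1r ?powR_ge0 //
      (le_trans _ (powR_ge0 _ _)) // oppr_le0 powR_ge0.
case: b' nar' leb leu => //= _ _ /(_ isT) {}leu.
(* Both signs are 0: the special value 0 lies below every power, and a nonzero [s] forces a nonzero
   [s']. *)
case: eqP => [_|/eqP u0].
  case: eqP => _; do 2 eexists; split => //.
  by rewrite expr0 mul1r powR_ge0.
rewrite ifF; last by apply/eqP; lia.
do 2 eexists; split => //.
by rewrite expr0 !mul1r ler_powR // le_magnitude.
Qed.

Theorem proposition4 (R : realType) (n : nat) (hn : (1 <= n)%N)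
  (B B' : n.-tuple bool)
  (hB : tval B <> NaR_string n) (hB' : tval B' <> NaR_string n) :
  tc_le B B' ->
  exists x y : R, [/\ takum R B = Some x, takum R B' = Some y & x <= y].
Proof.
have szB := size_tuple B; have szB' := size_tuple B'.
rewrite /tc_le /takum /ghost_extend.
case eB : (tval B) szB hB => [|b s] /= szB hB; first by rewrite -szB in hn.
case eB' : (tval B') szB' hB' => [|b' s'] /= szB' hB'; first by rewrite -szB' in hn.
have szE : size s' = size s by lia.
rewrite (SI_cons _ _ _ _ eB) (SI_cons _ _ _ _ eB') szE => le_SI.
have ltu := unsigned_lt s; have ltu' := unsigned_lt s'; rewrite szE in ltu'.
have not_nar a (u : seq bool) : (size u).+1 = n -> a :: u <> NaR_string n ->
    (a && (unsigned u == 0%N)) = false.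
  move=> szu nar; apply/negP => /andP[ha /eqP u0]; apply: nar.
  rewrite /NaR_string -szu ha /=; congr (_ :: _).
  by apply/all_pred1P; move/eqP: u0; rewrite unsigned_eq0; apply: sub_all => -[].
(* Ghost bits scale both values by the same power of 2, preserving their order and whether they
   vanish. *)
have unsigned_ghost (u : seq bool) k :
    unsigned (u ++ nseq k false) = (unsigned u * 2 ^ k)%N.
  by rewrite unsigned_cat unsigned_nseq_false size_nseq addn0.
apply: le_takum_long; rewrite ?size_cat ?size_nseq ?unsigned_ghost ?szE //.
- by lia.
- by rewrite muln_eq0 expn_eq0 orbF not_nar.
- by rewrite muln_eq0 expn_eq0 orbF not_nar.
(* A set sign bit makes [SI] negative, since the other bits are worth less than [2 ^ size s]. *)
- by case: (b) (b') le_SI => -[]; lia.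
- move=> /eqP eb; rewrite leq_mul2r; apply/orP; right.
  by move: le_SI; rewrite eb; lia.
Qed.
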